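(* Let $W\subset\mathbb{C}$ be a lattice with generators $\omega_1,\omega_2$, let $a\in\mathbb{C}$, let $\alpha_1<\beta_1$ and $\alpha_2<\beta_2$ be real numbers, and let $f$ be a complex-valued function such that $\Phi(x,y)=f(a+x\omega_1+y\omega_2)$ is defined on $[\alpha_1,\beta_1]\times[\alpha_2,\beta_2]$ and $\Phi\in C^{2}([\alpha_1,\beta_1]\times[\alpha_2,\beta_2])$. Then $$\sum_{\alpha_2<m\leq \beta_2}\ \sum_{\alpha_1<n\leq \beta_1} \Phi(n,m)=I_1+I_2+I_3+I_4,$$ where $n,m$ range over integers and $$I_1=\iint_{[\alpha_1,\beta_1]\times[\alpha_2,\beta_2]}\left[\Phi(x,y)+\frac{\partial \Phi(x,y)}{\partial x}P_1(x)+\frac{\partial \Phi(x,y)}{\partial y}P_1(y)+\frac{\partial^2\Phi(x,y)}{\partial x\partial y}P_1(x)P_1(y)\right]dx\,dy,$$ $$I_2=\int_{\alpha_2}^{\beta_2}\left[\Phi(\alpha_1,y)P_1(\alpha_1)-\Phi(\beta_1,y)P_1(\beta_1)+\frac{\partial\Phi(\alpha_1,y)}{\partial y}P_1(y)P_1(\alpha_1)-\frac{\partial\Phi(\beta_1,y)}{\partial y}P_1(y)P_1(\beta_1)\right]dy,$$ $$I_3=\int_{\alpha_1}^{\beta_1}\left[\Phi(x,\alpha_2)P_1(\alpha_2)-\Phi(x,\beta_2)P_1(\beta_2)+\frac{\partial\Phi(x,\alpha_2)}{\partial x}P_1(x)P_1(\alpha_2)-\frac{\partial\Phi(x,\beta_2)}{\partial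 x}P_1(x)P_1(\beta_2)\right]dx,$$ $$I_4=P_1(\alpha_2)P_1(\alpha_1)\Phi(\alpha_1,\alpha_2)-P_1(\alpha_2)P_1(\beta_1)\Phi(\beta_1,\alpha_2)-P_1(\beta_2)P_1(\alpha_1)\Phi(\alpha_1,\beta_2)+P_1(\beta_2)P_1(\beta_1)\Phi(\beta_1,\beta_2).$$
   Context: For real $x$, $[x]$ denotes the integer part (floor) of $x$, and $P_1(x)=B_1(x-[x])=x-[x]-\tfrac12$ is the first periodized Bernoulli polynomial. A lattice $W$ in $\mathbb{C}$ with generators $\omega_1,\omega_2$ is the set of points $n\omega_1+m\omega_2$ with $n,m\in\mathbb{Z}$, where $\omega_1,\omega_2$ are linearly independent over $\mathbb{R}$. *)

(* Defs.v *)
From HB Require Import structures.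
From mathcomp Require Import all_boot all_order all_algebra.
From mathcomp Require Import complex.
From mathcomp Require Import all_classical all_reals all_analysis.

Set Implicit Arguments.
Unset Strict Implicit.
Unset Printing Implicit Defensive.

Import Order.TTheory GRing.Theory Num.Theory.
Import numFieldNormedType.Exports.

Local Open Scope classical_set_scope.
Local Open Scope ring_scope.
Local Open Scope complex_scope.

Definition is_lattice (R : realType) (W : set R[i]) (w1 w2 : R[i]) : Prop :=
  (forall s t : R, s%:C * w1 + t%:C * w2 = 0 -> s = 0 /\ t = 0) /\
  W = [set z | exists n m : int, z = n%:~R * w1 + m%:~R * w2].

Definition P1 (R : realType) (x : R) : R := x - (Num.floor x)%:~R - 2^-1.

(* The topology on the complex numbers is that of [R[i]^o], i.e. the one given
   by the complex modulus.  Derivatives on [[a, b]] are limits of difference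
   quotients over points of [[a, b]] only, hence one-sided at the endpoints:
   the values of [g] outside [[a, b]] play no role. *)
Definition diffq (R : realType) (g : R -> R[i]) (x t : R) : R[i]^o :=
  (g t - g x) / (t - x)%:C.

Definition derivable_in (R : realType) (a b : R) (g : R -> R[i]) (x : R) :
    Prop :=
  cvg (diffq g x @ within `[a, b] x^').

Definition derive_in (R : realType) (a b : R) (g : R -> R[i]) (x : R) : R[i] :=
  lim (diffq g x @ within `[a, b] x^').

Definition dX (R : realType) (a1 b1 : R) (Phi : R -> R -> R[i]) (x y : R) :
    R[i] :=
  derive_in a1 b1 (Phi ^~ y) x.

Definition dY (R : realType) (a2 b2 : R) (Phi : R -> R -> R[i]) (x y : R) :
    R[i] :=
  derive_in a2 b2 (Phi x) y.

Definition rect (R : realType) (a1 b1 a2 b2 : R) : set (R * R) :=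
  `[a1, b1] `*` `[a2, b2].

Fixpoint Ck_rect (R : realType) (k : nat) (a1 b1 a2 b2 : R)
    (Phi : R -> R -> R[i]) : Prop :=
  {within rect a1 b1 a2 b2, continuous (fun z => Phi z.1 z.2 : R[i]^o)} /\
  if k is k'.+1 then
    [/\ forall x y, rect a1 b1 a2 b2 (x, y) ->
          derivable_in a1 b1 (Phi ^~ y) x /\ derivable_in a2 b2 (Phi x) y,
        Ck_rect k' a1 b1 a2 b2 (dX a1 b1 Phi) &
        Ck_rect k' a1 b1 a2 b2 (dY a2 b2 Phi)]
  else True.

(* The real integral is total, with a default value when [g] is not integrable;
   this does not matter for bounded measurable [g] on bounded intervals and
   rectangles. *)
Definition Cintegral (R : realType) (d : measure_display)
    (T : measurableType d) (mu : {measure set T -> \bar R}) (D : set T)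
    (g : T -> R[i]) : R[i] :=
  (\int[mu]_(t in D) complex.Re (g t)) +i* (\int[mu]_(t in D) complex.Im (g t)).

Definition Cint1 (R : realType) (a b : R) (g : R -> R[i]) : R[i] :=
  Cintegral (@lebesgue_measure R) `[a, b] g.

Definition Cint2 (R : realType) (a1 b1 a2 b2 : R) (g : R -> R -> R[i]) : R[i] :=
  Cintegral (@lebesgue_measure R \x @lebesgue_measure R)%E
    (rect a1 b1 a2 b2) (fun z => g z.1 z.2).

(* Main.v *)
Require Import Defs.
From mathcomp Require Import all_boot all_order all_algebra.
From mathcomp Require Import complex.
From mathcomp Require Import all_classical all_reals all_analysis.
From mathcomp Require Import measurable_realfun.
From mathcomp Require Import zify ring lra.
Import Order.TTheory GRing.Theory Num.Theory.
Import numFieldNormedType.Exports.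
Local Open Scope classical_set_scope.
Local Open Scope ring_scope.
Local Open Scope complex_scope.

Set Implicit Arguments.
Unset Strict Implicit.
Unset Printing Implicit Defensive.

(** The formula is the Euler-Maclaurin summation formula of order one, applied
    in each of the two variables.

    In one variable ([euler_maclaurin]) it rests on the remark that, for [x] in
    [[a, b]], the integer part of [x] is that of [a] plus the number of integers
    [n] with [a < n <= x] ([floor_count]).  Hence [g + g' P1] splits into the
    derivative of [g x * (x - c)], with [c] the integer part of [a] plus one
    half, minus one term [g' x * (n <= x)] for each integer [n] of [(a, b]].
    By the fundamental theorem of calculus the first contributes boundary
    values only and each of the others contributes [g b - g n], so that the sum
    of the [g n] appears without cutting [[a, b]] at the integers.

    In two variables ([euler_maclaurin_rect]) the one-variable formula is first
    applied in [y] for each fixed integer abscissa [n]; the finite sum over [n]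
    then goes under the integral over [y], where the one-variable formula in [x]
    is applied both to [H] and to its derivative in [y].  In this order the
    mixed derivative that shows up is the derivative in [x] of the derivative
    in [y], which is the one in the formula.  The iterated integral becomes a
    double one by Fubini ([Rintegral_setX]); the integrability that this
    requires comes from the boundedness and the product measurability of a
    function continuous on the rectangle ([measurable_within_rect]).

    The complex statement is the real one for the real and the imaginary parts
    ([euler_maclaurin_proj]): both are additive, compatible with the product by
    a real number, and bounded by the modulus, hence continuous. *)

(** * Integers in a half-open interval *)

(** The integers of [(a, b]] are the [int_after a i] for [i < gap a b]; counting
    them from [a] alone lets [b] vary, as [floor_count] requires. *)
Definition gap (R : realType) (a b : R) : nat :=
  absz (Num.floor b - Num.floor a)%R.

Definition int_after (R : realType) (a : R) (i : nat) : int :=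
  Num.floor a + (i.+1)%:Z.

Lemma gapE (R : realType) (a b : R) : a <= b ->
  (gap a b)%:Z = Num.floor b - Num.floor a.
Proof. by move=> ab; rewrite /gap gez0_abs// subr_ge0 le_floor. Qed.

Lemma int_after_le (R : realType) (a x : R) (i : nat) : a <= x ->
  ((int_after a i)%:~R <= x) = (i < gap a x)%N.
Proof.
move=> ax; rewrite -floor_ge_int /int_after -ltz_nat (gapE ax) ltrBrDl.
by rewrite -lezD1 intS; congr (_ <= _); ring.
Qed.

Lemma int_after_gt (R : realType) (a : R) (i : nat) : a < (int_after a i)%:~R.
Proof.
have /andP[_] := floor_itv a; move=> h; apply: (lt_le_trans h).
by rewrite ler_int /int_after lerD2l.
Qed.

Lemma fsum_int_itv (R : realType) (V : nmodType) (a b : R) (F : int -> V) :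
  a <= b ->
  \sum_(n \in [set n : int | a < n%:~R <= b]) F n =
  \sum_(i < gap a b) F (int_after a i).
Proof.
move=> ab; rewrite (fsbig_ord _ (gap a b) (fun i => F (int_after a i))).
apply: reindex_fsbig; split.
- move=> i /= ib; rewrite int_after_gt/= int_after_le//.
- by move=> i j _ _ /addrI[].
- move=> n /= /andP[an nb].
  have fa : Num.floor a < n.
    by rewrite -(ltr_int R); apply: le_lt_trans an; exact: floor_le.
  have nE : n = int_after a (absz (n - Num.floor a - 1)%R).
    by rewrite /int_after; lia.
  exists (absz (n - Num.floor a - 1)%R) => //=.
  by rewrite -(int_after_le _ ab) -nE.
Qed.

(** The integer part is a constant plus a finite sum of unit steps, which turns
    an integral against it into a finite sum of integrals over subintervals. *)
Lemma floor_count (R : realType) (a b x : R) : a <= x -> x <= b ->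
  (Num.floor x)%:~R = (Num.floor a)%:~R
    + \sum_(i < gap a b) ((int_after a i)%:~R <= x)%R%:R :> R.
Proof.
move=> ax xb.
have gab : (gap a x <= gap a b)%N.
  have := gapE ax; have := gapE (le_trans ax xb); have := le_floor xb.
  by lia.
under eq_bigr do rewrite int_after_le// .
rewrite -natr_sum (_ : (\sum_(i < gap a b) (i < gap a x))%N = gap a x).
  by rewrite -[(gap a x)%:R]/((gap a x)%:Z%:~R) gapE// intrB; ring.
rewrite -(big_mkord xpredT (fun i => nat_of_bool (i < gap a x)%N)).
rewrite (big_cat_nat _ gab)//= [X in (_ + X)%N]big_nat_cond [X in (_ + X)%N]big1; last first.
  by move=> i /andP[/andP[h _] _]; rewrite ltnNge h.
rewrite addn0 big_nat_cond (eq_bigr (fun=> 1%N)).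
  by rewrite -big_nat_cond sum_nat_const_nat muln1 subn0.
by move=> i /andP[/andP[_ ->]].
Qed.

(** * The summation formula in one variable *)

(** The derivative is required in the open interval only: with [g] and [g']
    continuous up to the endpoints, this is all that the fundamental theorem of
    calculus asks for, and it passes to subintervals. *)
Definition C1_on (R : realType) (a b : R) (g g' : R -> R) : Prop :=
  [/\ {within `[a, b], continuous g}, {within `[a, b], continuous g'}
    & forall x, a < x < b -> is_derive x 1 g (g' x)].

Lemma C1_onS (R : realType) (a b c d : R) (g g' : R -> R) :
  a <= c -> d <= b -> C1_on a b g g' -> C1_on c d g g'.
Proof.
move=> ac db [cg cg' dg].
have sub : `[c, d] `<=` `[a, b].
  by apply: subset_itvScc; rewrite bnd_simp.
split.
- exact: continuous_subspaceW cg.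
- exact: continuous_subspaceW cg'.
- by move=> x /andP[cx xd]; apply: dg; rewrite (le_lt_trans ac)//= (lt_le_trans xd).
Qed.

Lemma continuous_itv_integrable (R : realType) (a b : R) (g : R -> R) :
  {within `[a, b], continuous g} ->
  (@lebesgue_measure R).-integrable `[a, b] (EFin \o g).
Proof.
by move=> cg; apply: continuous_compact_integrable => //; exact: segment_compact.
Qed.

Lemma Rintegral_derive (R : realType) (a b : R) (g g' : R -> R) : a <= b ->
  C1_on a b g g' ->
  \int[@lebesgue_measure R]_(x in `[a, b]) g' x = g b - g a.
Proof.
rewrite le_eqVlt => /predU1P[<- _|ab [cg cg' dg]].
  by rewrite set_itv1 Rintegral_set1 subrr.
rewrite /Rintegral (@continuous_FTC2 _ g' g)//.
- have [_ ? ?] := (continuous_within_itvP _ ab).1 cg.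
  split => // x; rewrite in_itv/= => xab.
  by have := dg x xab; case.
- move=> x; rewrite in_itv/= => xab.
  by rewrite derive1E; apply: derive_val; exact: dg.
Qed.

Lemma measurable_P1 (R : realType) (D : set R) :
  measurable D -> measurable_fun D (@P1 R).
Proof.
move=> mD; apply: measurable_funB => //; apply: measurable_funB => //.
by apply: nondecreasing_measurable => // x y xy; rewrite ler_int le_floor.
Qed.

Lemma P1_bounded (R : realType) (x : R) : `|P1 x| <= 1.
Proof.
have /andP[h1 h2] := floor_itv x; rewrite intrD/= in h2.
by rewrite /P1 ler_norml; apply/andP; split; lra.
Qed.

Lemma integrable_bounded_mul d (T : measurableType d) (R : realType)
    (mu : {measure set T -> \bar R}) (D : set T) (f h : T -> R) :
  measurable D -> mu.-integrable D (EFin \o f) -> measurable_fun D h ->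
  (forall x, `|h x| <= 1) ->
  mu.-integrable D (EFin \o (fun x => f x * h x)).
Proof.
move=> mD intf mh h1.
have -> : EFin \o (fun x => f x * h x) = ((EFin \o f) \* (EFin \o h))%E by [].
apply: integrableMl => //.
exists 1; split => // M M1 x _ /=.
by apply: le_trans (h1 x) _; exact: ltW.
Qed.

Lemma integrable_bigsum d (T : measurableType d) (R : realType)
    (mu : {measure set T -> \bar R}) (D : set T) (I : Type) (s : seq I)
    (f : I -> T -> R) :
  measurable D -> (forall i, mu.-integrable D (EFin \o f i)) ->
  mu.-integrable D (EFin \o (fun x => \sum_(i <- s) f i x)).
Proof.
move=> mD intf.
have -> : EFin \o (fun x => \sum_(i <- s) f i x) =
    (fun x => \sum_(i <- s) (EFin \o f i) x)%E.
  by apply/funext => x /=; rewrite sumEFin.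
by apply: integrable_sum.
Qed.

Lemma Rintegral_bigsum d (T : measurableType d) (R : realType)
    (mu : {measure set T -> \bar R}) (D : set T) (I : Type) (s : seq I)
    (f : I -> T -> R) :
  measurable D -> (forall i, mu.-integrable D (EFin \o f i)) ->
  \int[mu]_(x in D) (\sum_(i <- s) f i x) =
  \sum_(i <- s) \int[mu]_(x in D) f i x.
Proof.
move=> mD intf; elim: s => [|i s IH].
  rewrite big_nil (@eq_Rintegral _ _ _ mu D (fun=> 0)).
    by rewrite Rintegral_cst// mul0r.
  by move=> x _; rewrite big_nil.
rewrite big_cons -IH -RintegralD//; last exact: integrable_bigsum.
by apply: eq_Rintegral => x _; rewrite big_cons.
Qed.

Lemma within_continuous_mul (R : realType) (A : set R) (f g : R -> R) :
  {within A, continuous f} -> {within A, continuous g} ->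
  {within A, continuous (fun x => f x * g x)}.
Proof. by move=> cf cg x; apply: cvgM; [exact: cf|exact: cg]. Qed.

Lemma C1_on_mul_affine (R : realType) (a b c : R) (g g' : R -> R) :
  C1_on a b g g' ->
  C1_on a b (fun x => g x * (x - c)) (fun x => g x + g' x * (x - c)).
Proof.
move=> [cg cg' dg].
have caff : {within `[a, b], continuous (fun x : R => x - c)}.
  by apply: continuous_subspaceT => x; apply: cvgB => //; exact: cvg_cst.
split.
- exact: within_continuous_mul.
- by apply: within_continuousD => //; exact: within_continuous_mul.
move=> x xab; have {}dg := dg x xab.
apply: is_derive_eq; rewrite subr0 scaler1 [_ *: _]mulrC//.
Qed.

(** The contribution of one unit step: cutting the integrand at [c] leaves the
    integral of [g'] over [[c, b]]. *)
Lemma Rintegral_derive_ge (R : realType) (a b c : R) (g g' : R -> R) :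
  a <= c -> c <= b -> C1_on a b g g' ->
  \int[@lebesgue_measure R]_(x in `[a, b]) (g' x * (c <= x)%R%:R) = g b - g c.
Proof.
move=> ac cb gC1; rewrite -(Rintegral_derive cb (C1_onS ac (lexx b) gC1)).
have -> : `[c, b]%classic = `[a, b] `&` `[c, b] :> set R.
  apply/seteqP; split => x /=; rewrite !in_itv/=; last by case.
  by move=> /andP[cx xb]; rewrite cx xb (le_trans ac cx).
rewrite Rintegral_mkcondr; apply: eq_Rintegral => x.
rewrite inE/= in_itv/= => /andP[ax xb].
rewrite /patch mem_setE/= in_itv/= xb andbT.
by case: ifP => _; rewrite ?mulr1 ?mulr0.
Qed.

Lemma measurable_fun_ge_indic (R : realType) (D : set R) (c : R) :
  measurable D -> measurable_fun D (fun x : R => (c <= x)%R%:R : R).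
Proof.
move=> mD; apply: nondecreasing_measurable => // x y xy.
rewrite ler_nat; case: (leP c x) => // cx.
by rewrite (le_trans cx xy).
Qed.

(** On [[a, b]], [x - c] exceeds [P1 x] by the number of integers of [(a, x]].
    The [gap a b] copies of [g b] left by the unit steps account for the
    difference between [b - c] and [P1 b]. *)
Lemma euler_maclaurin (R : realType) (a b : R) (g g' : R -> R) : a <= b ->
  C1_on a b g g' ->
  \sum_(i < gap a b) g (int_after a i)%:~R =
  \int[@lebesgue_measure R]_(x in `[a, b]) (g x + g' x * P1 x)
    + g a * P1 a - g b * P1 b.
Proof.
move=> ab gC1; set c : R := (Num.floor a)%:~R + 2^-1.
have hC1 := C1_on_mul_affine c gC1.
have [_ cg' _] := gC1; have [_ ch' _] := hC1.
set n := fun i : nat => (int_after a i)%:~R : R.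
have step i : (@lebesgue_measure R).-integrable `[a, b]
    (EFin \o (fun x => g' x * (n i <= x)%R%:R)).
  apply: integrable_bounded_mul => //.
  - exact: continuous_itv_integrable.
  - exact: measurable_fun_ge_indic.
  - by move=> x; case: (n i <= x); rewrite ?normr1 ?normr0.
have -> : \int[@lebesgue_measure R]_(x in `[a, b]) (g x + g' x * P1 x) =
  \int[@lebesgue_measure R]_(x in `[a, b])
     ((g x + g' x * (x - c)) -
      \sum_(i < gap a b) g' x * (n i <= x)%R%:R).
  apply: eq_Rintegral => x; rewrite inE/= in_itv/= => /andP[ax xb].
  by rewrite -mulr_sumr /P1 (floor_count ax xb) /c -/n; ring.
rewrite RintegralB//; last 2 first.
- exact: continuous_itv_integrable.
- exact: integrable_bigsum.
rewrite (Rintegral_derive ab hC1) Rintegral_bigsum//.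
under [X in _ - X + _ - _]eq_bigr => i _.
  rewrite (Rintegral_derive_ge _ _ gC1); last 2 first.
  - exact/ltW/int_after_gt.
  - by rewrite int_after_le.
  over.
rewrite sumrB sumr_const card_ord -mulr_natr.
have -> : (gap a b)%:R = (Num.floor b)%:~R - (Num.floor a)%:~R :> R.
  by rewrite -intrB -gapE.
by rewrite /P1 /c; field.
Qed.

(** * Functions continuous on a rectangle *)

Lemma cvg_to_within (T : Type) (U : topologicalType) (F : set_system T)
    (FF : Filter F) (f : T -> U) (A : set T) (B : set U) (u : U) :
  f @ F --> u -> (forall t, A t -> B (f t)) ->
  f @ within A F --> within B (nbhs u).
Proof.
move=> fu AB S BS; change (F [set t | A t -> S (f t)]).
by apply: (@filterS _ F FF _ _ _ (fu _ BS)) => t h At; exact/h/AB.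
Qed.

Lemma within_rect_slice1 (R : realType) (U : topologicalType)
    (a1 b1 a2 b2 y : R) (H : R -> R -> U) :
  {within rect a1 b1 a2 b2, continuous (fun z => H z.1 z.2)} ->
  a2 <= y <= b2 -> {within `[a1, b1], continuous (H ^~ y)}.
Proof.
move=> /subspace_continuousP cH yab; apply: ((@subspace_continuousP _ _ _ (H ^~ y)).2 _) => x xab.
apply: (@cvg_comp _ _ _ (fun t => (t, y)) _ _ _ _ _ (cH (x, y) (conj xab yab))).
apply: cvg_to_within => [|t tab]; last by split.
by apply: (@cvg_pair _ _ _ _ (nbhs x) (nbhs y)) => //; exact: cvg_cst.
Qed.

Lemma within_rect_slice2 (R : realType) (U : topologicalType)
    (a1 b1 a2 b2 x : R) (H : R -> R -> U) :
  {within rect a1 b1 a2 b2, continuous (fun z => H z.1 z.2)} ->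
  a1 <= x <= b1 -> {within `[a2, b2], continuous (H x)}.
Proof.
move=> /subspace_continuousP cH xab; apply: ((@subspace_continuousP _ _ _ (H x)).2 _) => y yab.
apply: (@cvg_comp _ _ _ (fun t => (x, t)) _ _ _ _ _ (cH (x, y) (conj xab yab))).
apply: cvg_to_within => [|t tab]; last by split.
by apply: (@cvg_pair _ _ _ _ (nbhs x) (nbhs y)) => //; exact: cvg_cst.
Qed.

Lemma measurable_rect (R : realType) (a1 b1 a2 b2 : R) :
  measurable (rect a1 b1 a2 b2).
Proof. exact: measurableX. Qed.

(** Clamping to [[a, b]] keeps every grid point, for every [k], in the interval
    where the function to be approximated is known to be continuous. *)
Definition grid (R : realType) (a b : R) (n : nat) (k : int) : R :=
  Num.min b (Num.max a (k%:~R / n.+1%:R)).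

Definition grid_floor (R : realType) (n : nat) (x : R) : int :=
  Num.floor (x * n.+1%:R).

Lemma grid_in (R : realType) (a b : R) (n : nat) (k : int) : a <= b ->
  a <= grid a b n k <= b.
Proof. by move=> ab; rewrite /grid le_min ab le_max lexx ge_min lexx. Qed.

Lemma grid_cvg (R : realType) (a b x : R) : a <= x -> x <= b ->
  grid a b n (grid_floor n x) @[n --> \oo] --> x.
Proof.
move=> ax xb.
apply: (@squeeze_cvgr _ _ _ _ (fun n => x - n.+1%:R^-1) (fun=> x)).
- near=> n; rewrite /grid /grid_floor.
  have n0 : 0 < n.+1%:R :> R by [].
  have /andP[h1 h2] := floor_itv (x * n.+1%:R); apply/andP; split.
  + rewrite le_min (le_trans _ xb)/=; last by rewrite gerBl invr_ge0.
    rewrite le_max; apply/orP; right.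
    rewrite ler_pdivlMr// mulrBl mulVf ?gt_eqF//.
    by rewrite lerBlDr (le_trans (ltW h2))// intrD.
  + by rewrite ge_min; apply/orP; right; rewrite ge_max ax/= ler_pdivrMr.
- rewrite -[X in _ --> X]subr0; apply: cvgB; first exact: cvg_cst.
  exact: cvg_harmonic.
- exact: cvg_cst.
Unshelve. all: by end_near. Qed.

Lemma measurable_grid_floor (R : realType) (n : nat) (k : int) :
  measurable [set x : R | grid_floor n x = k].
Proof.
have -> : [set x : R | grid_floor n x = k] =
    `[k%:~R / n.+1%:R, (k + 1)%:~R / n.+1%:R[%classic.
  apply/seteqP; split => x /=; rewrite in_itv/= /grid_floor.
    move=> <-; rewrite ler_pdivrMr// ltr_pdivlMr//; exact: floor_itv.
  by rewrite ler_pdivrMr// ltr_pdivlMr// => /floor_def.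
exact: measurable_itv.
Qed.

(** Rounding the first coordinate down to a grid gives functions that depend on
    it through countably many values only, so that their measurability reduces
    to that of the slices in the second coordinate.  By continuity they converge
    pointwise to the given function. *)
Lemma measurable_within_rect (R : realType) (a1 b1 a2 b2 : R)
    (H : R -> R -> R) : a1 <= b1 ->
  {within rect a1 b1 a2 b2, continuous (fun z => H z.1 z.2)} ->
  measurable_fun (rect a1 b1 a2 b2) (fun z => H z.1 z.2).
Proof.
move=> ab1 cH.
pose h n (z : R * R) := H (grid a1 b1 n (grid_floor n z.1)) z.2.
apply: (@measurable_fun_cvg _ _ _ _ h) => [n|[x y] [/= xab yab]].
- move=> _ Y mY.
  have -> : rect a1 b1 a2 b2 `&` h n @^-1` Y = \bigcup_(k : int)
      ((`[a1, b1] `&` [set x | grid_floor n x = k]) `*`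
       (`[a2, b2] `&` H (grid a1 b1 n k) @^-1` Y)).
    apply/seteqP; split => [[x y] [[/= ? ?] Yxy]|[x y] [k _ [/= [? <-] [? ?]]]].
      by exists (grid_floor n x).
    by split.
  apply: countable_bigcupT_measurable => // k.
  apply: measurableX.
    by apply: measurableI => //; exact: measurable_grid_floor.
  have ck := within_rect_slice2 cH (grid_in n k ab1).
  exact: (subspace_continuous_measurable_fun _ ck).
- move: cH => /subspace_continuousP /(_ (x, y)) /(_ (conj xab yab)) cH.
  rewrite /h/=.
  apply: (@cvg_comp _ _ _ (fun n => (grid a1 b1 n (grid_floor n x), y))
    (fun z => H z.1 z.2) _ _ _ _ cH).
  (* The sequence stays in the rectangle, so it converges within it. *)
  rewrite -[X in _ @ X]withinET.
  apply: cvg_to_within => [|n _]; last first.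
    by split => //=; rewrite in_itv/=; exact: grid_in.
  apply: (@cvg_pair _ _ _ _ (nbhs x) (nbhs y)); last exact: cvg_cst.
  by move: xab; rewrite /= in_itv/= => /andP[? ?]; exact: grid_cvg.
Qed.

Lemma integrable_within_rect (R : realType) (a1 b1 a2 b2 : R)
    (H : R -> R -> R) : a1 <= b1 ->
  {within rect a1 b1 a2 b2, continuous (fun z => H z.1 z.2)} ->
  (@lebesgue_measure R \x @lebesgue_measure R)%E.-integrable
    (rect a1 b1 a2 b2) (EFin \o (fun z => H z.1 z.2)).
Proof.
move=> ab1 cH; apply: measurable_bounded_integrable.
- exact: measurable_rect.
- suff : (@lebesgue_measure R `[a1, b1]%classic
      * @lebesgue_measure R `[a2, b2]%classic < +oo)%E.
    by rewrite -product_measure1E.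
  rewrite !lebesgue_measure_itv/=.
  by do 2 case: ifP => _; rewrite ?mule0 ?mul0e ?ltry// -?EFinB -?EFinM ltry.
- exact: measurable_within_rect.
- have : bounded_set [set H z.1 z.2 | z in rect a1 b1 a2 b2].
    apply: compact_bounded; apply: continuous_compact => //.
    by apply: compact_setX; exact: segment_compact.
  move=> [M [Mr HM]]; exists M; split => // N MN z Dz /=.
  by apply: (HM N MN); exists z.
Qed.

(** Fubini for real-valued integrals over a product set.  The integrability of
    every slice, and not of almost every one, ensures that the inner real-valued
    integral agrees everywhere with the extended one, for which the default value
    in the infinite case would otherwise intervene. *)
Lemma Rintegral_setX d1 d2 (T1 : measurableType d1) (T2 : measurableType d2)
    (R : realType) (m1 : {sigma_finite_measure set T1 -> \bar R})
    (m2 : {sigma_finite_measure set T2 -> \bar R})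
    (A : set T1) (B : set T2) (F : T1 -> T2 -> R) :
  measurable A -> measurable B ->
  (m1 \x m2)%E.-integrable (A `*` B) (EFin \o (fun z => F z.1 z.2)) ->
  (forall y, B y -> m1.-integrable A (EFin \o (F ^~ y))) ->
  m2.-integrable B (EFin \o (fun y => \int[m1]_(x in A) F x y)) /\
  \int[(m1 \x m2)%E]_(z in A `*` B) F z.1 z.2 =
  \int[m2]_(y in B) \int[m1]_(x in A) F x y.
Proof.
move=> mA mB intF intFy.
pose f := (EFin \o (fun z => F z.1 z.2)) \_ (A `*` B).
have mAB : measurable (A `*` B) by exact: measurableX.
have intf : (m1 \x m2)%E.-integrable setT f.
  by rewrite /f -integrable_mkcond.
have GE : fubini_G m1 f = (EFin \o (fun y => \int[m1]_(x in A) F x y)) \_ B.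
  apply/funext => y; rewrite /fubini_G patchE; case: ifPn => [yB|yB].
    rewrite /= /Rintegral fineK; last first.
      by apply: integrable_fin_num => //; apply: intFy; exact/set_mem.
    rewrite [RHS]integral_mkcond; apply: eq_integral => x _.
    by rewrite /f !patchE in_setX /= yB andbT.
  apply: integral0_eq => x _.
  by rewrite /f patchE in_setX /= (negbTE yB) andbF.
have intG : m2.-integrable setT (fubini_G m1 f).
  have mG := measurable_fubini_G intf.
  apply/integrableP; split => //.
  have mf := measurable_int _ intf.
  apply: le_lt_trans ((integrable21ltyP m1 m2 mf).1 intf).
  apply: ge0_le_integral => //.
  - exact: measurableT_comp.
  - apply: (@measurable_fun_fubini_tonelli_G _ _ _ _ _ m1 (abse \o f)) => //=.
    exact: measurableT_comp.
  - move=> y _; apply: le_abse_integral => //.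
    exact: measurableT_comp.
split.
  by rewrite integrable_mkcond// -GE.
rewrite /Rintegral; congr fine.
rewrite integral_mkcond [RHS]integral_mkcond.
transitivity (\int[m2]_y fubini_G m1 f y)%E; last by rewrite GE.
by rewrite integral21_prod_meas1.
Qed.

(** * The summation formula on a rectangle *)

Lemma integrable_add d (T : measurableType d) (R : realType)
    (mu : {measure set T -> \bar R}) (D : set T) (f g : T -> R) :
  measurable D -> mu.-integrable D (EFin \o f) ->
  mu.-integrable D (EFin \o g) ->
  mu.-integrable D (EFin \o (fun x => f x + g x)).
Proof. by move=> mD intf intg; exact: (integrableD mD intf intg). Qed.

Lemma integrable_sub d (T : measurableType d) (R : realType)
    (mu : {measure set T -> \bar R}) (D : set T) (f g : T -> R) :
  measurable D -> mu.-integrable D (EFin \o f) ->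
  mu.-integrable D (EFin \o g) ->
  mu.-integrable D (EFin \o (fun x => f x - g x)).
Proof. by move=> mD intf intg; exact: (integrableB mD intf intg). Qed.

Lemma integrable_mulr d (T : measurableType d) (R : realType)
    (mu : {measure set T -> \bar R}) (D : set T) (f : T -> R) (c : R) :
  measurable D -> mu.-integrable D (EFin \o f) ->
  mu.-integrable D (EFin \o (fun x => f x * c)).
Proof. by move=> mD intf; exact: (integrableZr mD c intf). Qed.

Lemma integrable_mulP1 (R : realType) (a b : R) (g : R -> R) :
  {within `[a, b], continuous g} ->
  (@lebesgue_measure R).-integrable `[a, b] (EFin \o (fun x => g x * P1 x)).
Proof.
move=> cg; apply: integrable_bounded_mul => //.
- exact: continuous_itv_integrable.
- exact: measurable_P1.
- exact: P1_bounded.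
Qed.

(** Applying the formula in [y] first produces the derivative in [x] of [Hy];
    the boundary terms in [x] of the inner formula, integrated over [y], are
    the second integral, and the boundary terms in [y] of the outer formula,
    summed over the abscissas, give the third one and the corner values. *)
Lemma euler_maclaurin_rect (R : realType) (a1 b1 a2 b2 : R)
    (H Hx Hy Hxy : R -> R -> R) :
  let C0 K := {within rect a1 b1 a2 b2,
                 continuous (fun z : R * R => K z.1 z.2 : R)} in
  a1 <= b1 -> a2 <= b2 -> C0 H -> C0 Hx -> C0 Hy -> C0 Hxy ->
  (forall x y, a1 < x < b1 -> a2 <= y <= b2 ->
     is_derive x 1 (H ^~ y) (Hx x y)) ->
  (forall x y, a1 <= x <= b1 -> a2 < y < b2 ->
     is_derive y 1 (H x) (Hy x y)) ->
  (forall x y, a1 < x < b1 -> a2 <= y <= b2 ->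
     is_derive x 1 (Hy ^~ y) (Hxy x y)) ->
  \sum_(j < gap a2 b2) \sum_(i < gap a1 b1)
     H (int_after a1 i)%:~R (int_after a2 j)%:~R =
  \int[(@lebesgue_measure R \x @lebesgue_measure R)%E]_(z in rect a1 b1 a2 b2)
     (H z.1 z.2 + Hx z.1 z.2 * P1 z.1 + Hy z.1 z.2 * P1 z.2
        + Hxy z.1 z.2 * P1 z.1 * P1 z.2)
  + \int[@lebesgue_measure R]_(y in `[a2, b2])
     (H a1 y * P1 a1 - H b1 y * P1 b1
        + Hy a1 y * P1 y * P1 a1 - Hy b1 y * P1 y * P1 b1)
  + \int[@lebesgue_measure R]_(x in `[a1, b1])
     (H x a2 * P1 a2 - H x b2 * P1 b2
        + Hx x a2 * P1 x * P1 a2 - Hx x b2 * P1 x * P1 b2)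
  + (P1 a2 * P1 a1 * H a1 a2 - P1 a2 * P1 b1 * H b1 a2
       - P1 b2 * P1 a1 * H a1 b2 + P1 b2 * P1 b1 * H b1 b2).
Proof.
move=> C0 ab1 ab2 cH cHx cHy cHxy dHx dHy dHxy.
have C1x y : a2 <= y <= b2 -> C1_on a1 b1 (H ^~ y) (Hx ^~ y).
  move=> yab; split; [exact: within_rect_slice1 cH yab|
    exact: within_rect_slice1 cHx yab|by move=> x xab; exact: dHx].
have C1xy y : a2 <= y <= b2 -> C1_on a1 b1 (Hy ^~ y) (Hxy ^~ y).
  move=> yab; split; [exact: within_rect_slice1 cHy yab|
    exact: within_rect_slice1 cHxy yab|by move=> x xab; exact: dHxy].
have C1y x : a1 <= x <= b1 -> C1_on a2 b2 (H x) (Hy x).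
  move=> xab; split; [exact: within_rect_slice2 cH xab|
    exact: within_rect_slice2 cHy xab|by move=> y yab; exact: dHy].
have a1in : a1 <= a1 <= b1 by rewrite lexx.
have b1in : a1 <= b1 <= b1 by rewrite lexx andbT.
have a2in : a2 <= a2 <= b2 by rewrite lexx.
have b2in : a2 <= b2 <= b2 by rewrite lexx andbT.
have nin (i : 'I_(gap a1 b1)) : a1 <= (int_after a1 i)%:~R <= b1.
  by rewrite (ltW (int_after_gt _ _)) int_after_le/=.
set mu := @lebesgue_measure R.
pose F x y := H x y + Hx x y * P1 x + Hy x y * P1 y + Hxy x y * P1 x * P1 y.
pose B y := H a1 y * P1 a1 - H b1 y * P1 b1
  + Hy a1 y * P1 y * P1 a1 - Hy b1 y * P1 y * P1 b1.
pose E y x := H x y + Hx x y * P1 x.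
pose Ey y x := Hy x y + Hxy x y * P1 x.
have intE y : a2 <= y <= b2 -> mu.-integrable `[a1, b1] (EFin \o E y).
  move=> /C1x[c0 c1 _]; apply: integrable_add => //.
    exact: continuous_itv_integrable.
  exact: integrable_mulP1.
have intEy y : a2 <= y <= b2 -> mu.-integrable `[a1, b1] (EFin \o Ey y).
  move=> /C1xy[c0 c1 _]; apply: integrable_add => //.
    exact: continuous_itv_integrable.
  exact: integrable_mulP1.
have FE y : F ^~ y = (fun x => E y x + Ey y x * P1 y).
  by apply/funext => x; rewrite /F /E /Ey; ring.
have intF y : `[a2, b2]%classic y -> mu.-integrable `[a1, b1] (EFin \o F ^~ y).
  rewrite /= in_itv/= => yab; rewrite FE; apply: integrable_add => //.
    exact: intE.
  by apply: integrable_mulr => //; exact: intEy.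
have mP1 : measurable_fun (rect a1 b1 a2 b2) (fun z : R * R => P1 z.1).
  apply: (measurable_funTS (f := @P1 R \o fst)).
  by apply: measurableT_comp => //; exact: measurable_P1.
have mP2 : measurable_fun (rect a1 b1 a2 b2) (fun z : R * R => P1 z.2).
  apply: (measurable_funTS (f := @P1 R \o snd)).
  by apply: measurableT_comp => //; exact: measurable_P1.
have mrect := measurable_rect a1 b1 a2 b2.
have intF2 : (mu \x mu)%E.-integrable (`[a1, b1] `*` `[a2, b2])
    (EFin \o (fun z => F z.1 z.2)).
  have ic K : C0 K -> (mu \x mu)%E.-integrable (rect a1 b1 a2 b2)
      (EFin \o (fun z => K z.1 z.2)) by exact: integrable_within_rect.
  have i1 K : C0 K -> (mu \x mu)%E.-integrable (rect a1 b1 a2 b2)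
      (EFin \o (fun z => K z.1 z.2 * P1 z.1)).
    move=> cK; apply: integrable_bounded_mul => //; first exact: ic.
    by move=> z; exact: P1_bounded.
  apply: integrable_add => //; last first.
    apply: integrable_bounded_mul => //; first exact: i1.
    by move=> z; exact: P1_bounded.
  apply: integrable_add => //; last first.
    apply: integrable_bounded_mul => //; first exact: ic.
    by move=> z; exact: P1_bounded.
  apply: integrable_add => //; [exact: ic|exact: i1].
have [intG ->] : mu.-integrable `[a2, b2]
      (EFin \o (fun y => \int[mu]_(x in `[a1, b1]) F x y)) /\
    \int[(mu \x mu)%E]_(z in rect a1 b1 a2 b2) F z.1 z.2 =
    \int[mu]_(y in `[a2, b2]) \int[mu]_(x in `[a1, b1]) F x y.
  by apply: Rintegral_setX.
have iy x : a1 <= x <= b1 -> mu.-integrable `[a2, b2] (EFin \o H x).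
  by move=> /C1y[c0 _ _]; exact: continuous_itv_integrable.
have iyP x : a1 <= x <= b1 ->
    mu.-integrable `[a2, b2] (EFin \o (fun y => Hy x y * P1 y)).
  by move=> /C1y[_ c1 _]; exact: integrable_mulP1.
have intB : mu.-integrable `[a2, b2] (EFin \o B).
  apply: integrable_sub => //; last first.
    by apply: integrable_mulr => //; exact: iyP.
  apply: integrable_add => //; last first.
    by apply: integrable_mulr => //; exact: iyP.
  apply: integrable_sub => //; by apply: integrable_mulr => //; exact: iy.
have sumx y : a2 <= y <= b2 -> \sum_(i < gap a1 b1) H (int_after a1 i)%:~R y
    = \int[mu]_(x in `[a1, b1]) E y x + H a1 y * P1 a1 - H b1 y * P1 b1.
  by move=> /C1x; exact: euler_maclaurin.
have sumxy y : a2 <= y <= b2 -> \sum_(i < gap a1 b1) Hy (int_after a1 i)%:~R y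
    = \int[mu]_(x in `[a1, b1]) Ey y x + Hy a1 y * P1 a1 - Hy b1 y * P1 b1.
  by move=> /C1xy; exact: euler_maclaurin.
have inner y : a2 <= y <= b2 ->
    \sum_(i < gap a1 b1) (H (int_after a1 i)%:~R y
       + Hy (int_after a1 i)%:~R y * P1 y) =
    \int[mu]_(x in `[a1, b1]) F x y + B y.
  move=> yab; rewrite big_split/= -mulr_suml sumx// sumxy//.
  have -> : \int[mu]_(x in `[a1, b1]) F x y =
      \int[mu]_(x in `[a1, b1]) E y x + \int[mu]_(x in `[a1, b1]) Ey y x * P1 y.
    rewrite -RintegralZr//; last exact: intEy.
    rewrite -RintegralD//; first by rewrite -[in RHS]FE.
      exact: intE.
    by apply: integrable_mulr => //; exact: intEy.
  by rewrite /B; ring.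
rewrite exchange_big/=.
under eq_bigr => i _ do rewrite (euler_maclaurin ab2 (C1y _ (nin i))).
rewrite sumrB big_split/= -!mulr_suml sumx// sumx//.
rewrite -Rintegral_bigsum//; last first.
  by move=> i; apply: integrable_add => //; [exact: iy|exact: iyP].
have -> : \int[mu]_(y in `[a2, b2]) (\sum_(i < gap a1 b1)
      (H (int_after a1 i)%:~R y + Hy (int_after a1 i)%:~R y * P1 y)) =
    \int[mu]_(y in `[a2, b2]) \int[mu]_(x in `[a1, b1]) F x y
    + \int[mu]_(y in `[a2, b2]) B y.
  rewrite -RintegralD//; apply: eq_Rintegral => y.
  by rewrite inE/= in_itv/= => yab; exact: inner.
have -> : \int[mu]_(x in `[a1, b1])
     (H x a2 * P1 a2 - H x b2 * P1 b2
        + Hx x a2 * P1 x * P1 a2 - Hx x b2 * P1 x * P1 b2) =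
   \int[mu]_(x in `[a1, b1]) E a2 x * P1 a2
   - \int[mu]_(x in `[a1, b1]) E b2 x * P1 b2.
  rewrite -RintegralZr//; last exact: intE.
  rewrite -RintegralZr//; last exact: intE.
  rewrite -RintegralB//; last 2 first.
    by apply: integrable_mulr => //; exact: intE.
    by apply: integrable_mulr => //; exact: intE.
  by apply: eq_Rintegral => x _; rewrite /E; ring.
by rewrite /B; ring.
Qed.

(** * Real and imaginary parts *)

Lemma normc_ge_Im (R : realType) (z : R[i]) : `|complex.Im z|%:C <= `|z|.
Proof.
have := normc_ge_Re (z * 'i); rewrite ReiNIm normrN normrM.
by rewrite [X in _ * X]normc_def/= expr0n/= add0r expr1n sqrtr1 mulr1.
Qed.

Lemma continuous_proj (R : realType) (p : R[i] -> R) :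
  {morph p : x y / x + y} -> {morph p : x / - x} ->
  (forall z, `|p z|%:C <= `|z|) -> continuous (p : R[i]^o -> R).
Proof.
move=> pD pN ple z A /nbhs_ballP[e /= e0 eA].
apply/(@nbhs_ballP _ R[i]^o); exists e%:C => /=; first by rewrite ltcR.
move=> t; rewrite -ball_normE/= => zt; apply: eA; rewrite -ball_normE/=.
by rewrite -pN -pD -ltcR; apply: le_lt_trans zt; exact: ple.
Qed.

Lemma is_derive_dnbhs (R : realType) (f : R -> R) (x l : R) :
  (f t - f x) / (t - x) @[t --> x^'] --> l -> is_derive x 1 f l.
Proof.
move=> fl.
have fh : h^-1 *: (f (h *: 1 + x) - f x) @[h --> 0^'] --> l.
  have sh : h + x @[h --> 0^'] --> x^'.
    apply: cvg_to_within => [|t t0]; last by rewrite /= -subr_eq0 addrK.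
    rewrite -[X in _ --> X]add0r; apply: cvgD; last exact: cvg_cst.
    exact: cvg_id.
  have := cvg_comp _ _ sh fl; apply: cvg_trans; apply: near_eq_cvg.
  by near=> h; rewrite /= addrK scaler1 mulrC.
apply: DeriveDef; first by apply: cvgP fh.
exact: cvg_lim fh.
Unshelve. all: by end_near. Qed.

(** At an interior point the constraint that [t] lies in [[a, b]] is eventually
    void, so the limit within [[a, b]] is the usual two-sided derivative. *)
Lemma is_derive_proj (R : realType) (p : R[i] -> R) (a b x : R)
    (g : R -> R[i]) :
  {morph p : x y / x + y} -> {morph p : x / - x} ->
  (forall z r, p (z * r%:C) = p z * r) ->
  continuous (p : R[i]^o -> R) ->
  derivable_in a b g x -> a < x < b ->
  is_derive x 1 (p \o g) (p (derive_in a b g x)).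
Proof.
move=> pD pN pM cp dg /andP[ax xb]; apply: is_derive_dnbhs.
have : p (diffq g x t) @[t --> within `[a, b] x^'] --> p (derive_in a b g x).
  apply: (cvg_comp (diffq g x) (p : R[i]^o -> R) dg).
  exact: cp.
have -> : (fun t => p (diffq g x t)) =
    (fun t => ((p \o g) t - (p \o g) x) / (t - x)).
  by apply/funext => t; rewrite /diffq -fmorphV pM pD pN.
apply: cvg_trans; apply: cvg_app => S wS.
have xab : \forall t \near x^', `[a, b]%classic t.
  apply: cvg_within; have xab : x \in `]a, b[ by rewrite in_itv/= ax.
  by apply: filterS (near_in_itvoo xab) => t; exact: subset_itv_oo_cc.
by near=> t; (have : `[a, b]%classic t by near: t); near: t.
Unshelve. all: by end_near. Qed.

(** The hypotheses on [p] are those shared by the real and the imaginary parts;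
    they let the two components be treated at once. *)
Lemma euler_maclaurin_proj (R : realType) (p : R[i] -> R)
    (a1 b1 a2 b2 : R) (Phi : R -> R -> R[i]) :
  {morph p : x y / x + y} -> {morph p : x / - x} ->
  (forall z r, p (z * r%:C) = p z * r) ->
  (forall z, `|p z|%:C <= `|z|) ->
  a1 <= b1 -> a2 <= b2 -> Ck_rect 2 a1 b1 a2 b2 Phi ->
  let Phix := dX a1 b1 Phi in
  let Phiy := dY a2 b2 Phi in
  let Phixy := dX a1 b1 (dY a2 b2 Phi) in
  p (\sum_(j < gap a2 b2) \sum_(i < gap a1 b1)
     Phi (int_after a1 i)%:~R (int_after a2 j)%:~R) =
  \int[(@lebesgue_measure R \x @lebesgue_measure R)%E]_(z in rect a1 b1 a2 b2)
     p (Phi z.1 z.2 + Phix z.1 z.2 * (P1 z.1)%:C + Phiy z.1 z.2 * (P1 z.2)%:C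
      + Phixy z.1 z.2 * (P1 z.1)%:C * (P1 z.2)%:C)
  + \int[@lebesgue_measure R]_(y in `[a2, b2])
     p (Phi a1 y * (P1 a1)%:C - Phi b1 y * (P1 b1)%:C
      + Phiy a1 y * (P1 y)%:C * (P1 a1)%:C
      - Phiy b1 y * (P1 y)%:C * (P1 b1)%:C)
  + \int[@lebesgue_measure R]_(x in `[a1, b1])
     p (Phi x a2 * (P1 a2)%:C - Phi x b2 * (P1 b2)%:C
      + Phix x a2 * (P1 x)%:C * (P1 a2)%:C
      - Phix x b2 * (P1 x)%:C * (P1 b2)%:C)
  + p ((P1 a2)%:C * (P1 a1)%:C * Phi a1 a2
      - (P1 a2)%:C * (P1 b1)%:C * Phi b1 a2
      - (P1 b2)%:C * (P1 a1)%:C * Phi a1 b2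
      + (P1 b2)%:C * (P1 b1)%:C * Phi b1 b2).
Proof.
move=> pD pN pM ple ab1 ab2 [cH [dH [cHx _] [cHy [dHy [cHxy _] _]]]].
move=> Phix Phiy Phixy.
have cp := continuous_proj pD pN ple.
have p0 : p 0 = 0 by rewrite -[0](mul0r (0 : R)%:C) pM mulr0.
have cK K : {within rect a1 b1 a2 b2,
      continuous (fun z => K z.1 z.2 : R[i]^o)} ->
    {within rect a1 b1 a2 b2, continuous (fun z => p (K z.1 z.2))}.
  by move=> c z; apply: (cvg_comp _ _ (c z)); exact: cp.
rewrite (big_morph p pD p0).
under eq_bigr do rewrite (big_morph p pD p0).
have ends (u v t : R) : u < t < v -> u <= t <= v.
  by move=> /andP[/ltW -> /ltW ->].
have dx x y : a1 < x < b1 -> a2 <= y <= b2 ->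
    is_derive x 1 (fun x' => p (Phi x' y)) (p (Phix x y)).
  move=> xab yab; apply: (is_derive_proj pD pN pM cp _ xab).
  have {}xab := ends _ _ _ xab.
  have xyin : rect a1 b1 a2 b2 (x, y) by split; rewrite /= in_itv.
  exact: (dH x y xyin).1.
have dy x y : a1 <= x <= b1 -> a2 < y < b2 ->
    is_derive y 1 (fun y' => p (Phi x y')) (p (Phiy x y)).
  move=> xab yab; apply: (is_derive_proj pD pN pM cp _ yab).
  have {}yab := ends _ _ _ yab.
  have xyin : rect a1 b1 a2 b2 (x, y) by split; rewrite /= in_itv.
  exact: (dH x y xyin).2.
have dxy x y : a1 < x < b1 -> a2 <= y <= b2 ->
    is_derive x 1 (fun x' => p (Phiy x' y)) (p (Phixy x y)).
  move=> xab yab; apply: (is_derive_proj pD pN pM cp _ xab).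
  have {}xab := ends _ _ _ xab.
  have xyin : rect a1 b1 a2 b2 (x, y) by split; rewrite /= in_itv.
  exact: (dHy x y xyin).1.
have EM := (euler_maclaurin_rect ab1 ab2 (cK _ cH) (cK _ cHx) (cK _ cHy)
  (cK _ cHxy) dx dy dxy).
rewrite EM.
congr (_ + _ + _ + _).
- by apply: eq_Rintegral => z _; rewrite !pD !pM.
- by apply: eq_Rintegral => y _; rewrite !(pD, pN, pM).
- by apply: eq_Rintegral => x _; rewrite !(pD, pN, pM).
- have pM2 r s z : p (r%:C * s%:C * z) = r * s * p z.
    by rewrite -rmorphM mulrC pM mulrC.
  by rewrite !(pD, pN, pM2).
Qed.

Theorem proposition1p2 (R : realType) (W : set R[i]) (w1 w2 : R[i])
    (hW : is_lattice W w1 w2) (a : R[i])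
    (a1 b1 a2 b2 : R) (h1 : a1 < b1) (h2 : a2 < b2)
    (f : R[i] -> R[i]) (Phi : R -> R -> R[i])
    (hPhi : forall x y : R, rect a1 b1 a2 b2 (x, y) ->
       Phi x y = f (a + x%:C * w1 + y%:C * w2))
    (hC2 : Ck_rect 2 a1 b1 a2 b2 Phi) :
  let Phix := dX a1 b1 Phi in
  let Phiy := dY a2 b2 Phi in
  let Phixy := dX a1 b1 (dY a2 b2 Phi) in
  let I1 := Cint2 a1 b1 a2 b2 (fun x y =>
    Phi x y + Phix x y * (P1 x)%:C + Phiy x y * (P1 y)%:C
      + Phixy x y * (P1 x)%:C * (P1 y)%:C) in
  let I2 := Cint1 a2 b2 (fun y =>
    Phi a1 y * (P1 a1)%:C - Phi b1 y * (P1 b1)%:C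
      + Phiy a1 y * (P1 y)%:C * (P1 a1)%:C
      - Phiy b1 y * (P1 y)%:C * (P1 b1)%:C) in
  let I3 := Cint1 a1 b1 (fun x =>
    Phi x a2 * (P1 a2)%:C - Phi x b2 * (P1 b2)%:C
      + Phix x a2 * (P1 x)%:C * (P1 a2)%:C
      - Phix x b2 * (P1 x)%:C * (P1 b2)%:C) in
  let I4 :=
    (P1 a2)%:C * (P1 a1)%:C * Phi a1 a2 - (P1 a2)%:C * (P1 b1)%:C * Phi b1 a2
      - (P1 b2)%:C * (P1 a1)%:C * Phi a1 b2
      + (P1 b2)%:C * (P1 b1)%:C * Phi b1 b2 in
  \sum_(m \in [set m : int | a2 < m%:~R <= b2])
    \sum_(n \in [set n : int | a1 < n%:~R <= b1]) Phi n%:~R m%:~R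
  = I1 + I2 + I3 + I4.
Proof.
move=> Phix Phiy Phixy I1 I2 I3 I4.
rewrite (fsum_int_itv _ (ltW h2)).
under eq_bigr => j _ do rewrite (fsum_int_itv _ (ltW h1)).
have ReD : {morph @complex.Re R : x y / x + y} by move=> [? ?] [? ?].
have ImD : {morph @complex.Im R : x y / x + y} by move=> [? ?] [? ?].
have ReN : {morph @complex.Re R : x / - x} by move=> [? ?].
have ImN : {morph @complex.Im R : x / - x} by move=> [? ?].
have ReM z (r : R) : complex.Re (z * r%:C) = complex.Re z * r.
  by case: z => u v /=; rewrite mulr0 subr0.
have ImM z (r : R) : complex.Im (z * r%:C) = complex.Im z * r.
  by case: z => u v /=; rewrite mulr0 add0r.
apply/eqP; rewrite eq_complex; apply/andP; split; apply/eqP.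
- by rewrite (euler_maclaurin_proj ReD ReN ReM (@normc_ge_Re R)
    (ltW h1) (ltW h2) hC2) !ReD.
- by rewrite (euler_maclaurin_proj ImD ImN ImM (@normc_ge_Im R)
    (ltW h1) (ltW h2) hC2) !ImD.
Qed.
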